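(* There exists a stochastic block model $\mathrm{SBM}(n;p,Q)$ on $k=2$ communities with $p=(1/2,1/2)$ which has the following properties. - For any graph $H$ with an odd degree vertex, $\Phi_{\mathrm{SBM}(p,Q)}(H)=0$. - For any graph $H$ without odd degree vertices, $\Phi_{\mathrm{SBM}(p,Q)}(H)=1$. - As $n$ grows, $\mathrm{SBM}(n;p,Q)$ can be distinguished from $\mathbb{G}(n,1/2)$ via the signed 4-cycle count. - For any fixed graph $H$ without isolated vertices and with at least one edge, the signed count of $H$ distinguishes $\mathrm{SBM}(n;p,|Q|)$ and $\mathbb{G}(n,1/2)$ as $n$ grows, where $|Q|$ is the entry-wise absolute value of $Q$.
   Context: Graphs are finite, simple and undirected. $\mathbb{G}(n,1/2)$ is the Erdős–Rényi random graph. A stochastic block model on $k$ communities is given by a probability vector $p\in(0,1]^k$ and a symmetric matrix $Q\in[-1,1]^{k\times k}$. A sample $\mathbf{G}\sim\mathrm{SBM}(n;p,Q)$ is an $n$-vertex graph produced by drawing i.i.d. labels $\mathbf{x}_1,\dots,\mathbf{x}_n\in[k]$ with pmf $p$, and then including each edge $(i,j)$ independently with probability $(1+Q_{\mathbf{x}_i,\mathbf{x}_j})/2$. For a graph $H$ (placed on any $|V(H)|$ of the vertices, $n\ge|V(H)|$), $\Phi_{\mathrm{SBM}(p,Q)}(H)=\mathbb{E}_{\mathbf{G}\sim\mathrm{SBM}(n;p,Q)}\big[\prod_{(i,j)\in E(H)}(2\mathbf{G}_{ij}-1)\big]$ (independent of $n$ and of the placement). The signed count of $H$ in an $n$-vertex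 graph $G$ is $\mathrm{SC}_H(G)=\sum_{H_1\sim H}\prod_{(i,j)\in E(H_1)}(2G_{ij}-1)$, the sum over all subgraphs $H_1$ of $K_n$ isomorphic to $H$. The signed count of $H$ distinguishes $\mathbb{P}_n$ from $\mathbb{G}(n,1/2)$ (with high probability) if, for $f=\mathrm{SC}_H$, $|\mathbb{E}_{\mathbb{P}_n}f-\mathbb{E}_{\mathbb{G}(n,1/2)}f|=\omega\big(\max(\mathrm{Var}_{\mathbb{G}(n,1/2)}[f]^{1/2},\mathrm{Var}_{\mathbb{P}_n}[f]^{1/2})\big)$ as $n\to\infty$, where $y=\omega(x)$ means $x/y\to0$. *)

(* Defs.v *)
From HB Require Import structures.
From mathcomp Require Import all_boot all_order all_algebra.
From mathcomp Require Import all_classical all_reals all_analysis.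

Set Implicit Arguments.
Unset Strict Implicit.
Unset Printing Implicit Defensive.

Import Order.TTheory GRing.Theory Num.Theory.
Import numFieldNormedType.Exports.

Local Open Scope ring_scope.
Local Open Scope set_scope.

(* An edge is the unordered pair of its endpoints; this rules out loops and
   multiple edges. *)
Record graph (T : finType) := Graph {
  edges : {set {set T}};
  edges_card2 : [forall e in edges, #|e| == 2%N]
}.

HB.instance Definition _ (T : finType) := [isSub for @edges T].
HB.instance Definition _ (T : finType) := [Equality of graph T by <:].
HB.instance Definition _ (T : finType) := [Choice of graph T by <:].
HB.instance Definition _ (T : finType) := [Countable of graph T by <:].
HB.instance Definition _ (T : finType) := [Finite of graph T by <:].

Definition degree (T : finType) (H : graph T) (v : T) : nat :=
  #|[set e in edges H | v \in e]|.

Lemma cycle4_card2 :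
  [forall e in [set [set i; ordS i] | i : 'I_4], #|e| == 2%N].
Proof.
apply/forall_inP => e /imsetP[i _ ->].
rewrite cards2; case: i => -[|[|[|[|]]]] //.
Qed.

Definition cycle4 : graph 'I_4 := Graph cycle4_card2.

(* Laws on finite graphs are given by their probability mass functions. *)
Section Probability.
Variable R : realType.

Definition expectation (T : finType) (mu : graph T -> R) (f : graph T -> R) : R :=
  \sum_(G : graph T) mu G * f G.

Definition variance (T : finType) (mu : graph T -> R) (f : graph T -> R) : R :=
  expectation mu (fun G => (f G - expectation mu f) ^+ 2).

(* Each pair i < j is an edge with probability W i j, independently. *)
Definition independent_edges (n : nat) (W : 'I_n -> 'I_n -> R)
    (G : graph 'I_n) : R :=
  \prod_(i < n) \prod_(j < n | (i < j)%N)
    if [set i; j] \in edges G then W i j else 1 - W i j.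

Definition erdos_renyi (q : R) (n : nat) : graph 'I_n -> R :=
  independent_edges (fun _ _ => q).

Definition sbm_parameters (k : nat) (p : 'rV[R]_k) (Q : 'M[R]_k) : Prop :=
  [/\ forall a, 0 < p 0 a <= 1,
      \sum_a p 0 a = 1,
      forall a b, Q a b = Q b a
    & forall a b, -1 <= Q a b <= 1].

(* The labels x are summed out: this is the marginal law of the graph alone. *)
Definition sbm (k : nat) (p : 'rV[R]_k) (Q : 'M[R]_k) (n : nat)
    (G : graph 'I_n) : R :=
  \sum_(x : {ffun 'I_n -> 'I_k})
    (\prod_(i < n) p 0 (x i)) *
    independent_edges (fun i j => (1 + Q (x i) (x j)) / 2) G.

(* The factor for e is 2 G_e - 1, i.e. 1 if e is an edge of G, -1 otherwise. *)
Definition signed_weight (T : finType) (E : {set {set T}}) (G : graph T) : R :=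
  \prod_(e in E) (2 * (e \in edges G)%:R - 1).

Definition image_edges (T U : finType) (f : T -> U) (H : graph T) :
    {set {set U}} :=
  [set [set f v | v in e] | e : {set T} in edges H].

(* Phi(H), computed with H placed on the vertices f v, for f injective. *)
Definition Phi (k : nat) (p : 'rV[R]_k) (Q : 'M[R]_k) (T : finType)
    (H : graph T) (n : nat) (f : T -> 'I_n) : R :=
  expectation (@sbm k p Q n) (signed_weight (image_edges f H)).

(* The subgraphs (vertex set, edge set) of K_n isomorphic to H. The vertex set
   is kept so that isolated vertices of H are accounted for. *)
Definition copies (T : finType) (H : graph T) (n : nat) :
    {set {set 'I_n} * {set {set 'I_n}}} :=
  [set ([set f v | v : T], image_edges f H)
     | f : {ffun T -> 'I_n} in [pred f : {ffun T -> 'I_n} | injectiveb f]].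

Definition signed_count (T : finType) (H : graph T) (n : nat)
    (G : graph 'I_n) : R :=
  \sum_(H1 in copies H n) signed_weight H1.2 G.

(* y = omega(x). As x / 0 = 0 in MathComp, the condition that y is eventually
   nonzero has to be stated separately. *)
Definition is_omega (y x : nat -> R) : Prop :=
  (\forall n \near \oo%classic, y n != 0) /\
  ((fun n => x n / y n) @ \oo --> (0 : R))%classic.

Definition distinguishes (f : forall n, graph 'I_n -> R)
    (P : forall n, graph 'I_n -> R) : Prop :=
  let P0 := fun n => @erdos_renyi (1 / 2) n in
  is_omega
    (fun n => `|expectation (P n) (f n) - expectation (P0 n) (f n)|)
    (fun n => Num.max (Num.sqrt (variance (P0 n) (f n)))
                      (Num.sqrt (variance (P n) (f n)))).

End Probability.

(* Main.v *)
(** Take Q = s s^T with s = (1, -1), so that |Q| is the all-ones matrix, of the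
    same rank-one shape with s = (1, 1).  For such a Q the Fourier coefficient
    factors over the vertices, Phi(H) = prod_v sum_a p_a s_a^(deg v).

    Whenever Phi(H) = 1, the signed weight of every copy of H, being bounded
    by 1, is almost surely 1.  The signed count is then almost surely the number
    N of copies, whereas under G(n,1/2) it has mean 0 and variance N by
    orthogonality of the signed weights.  The ratio sqrt N / N tends to 0, since
    every vertex lies in some copy and hence n <= N |V(H)|. *)

Require Import Defs.
From HB Require Import structures.
From mathcomp Require Import all_boot all_order all_algebra.
From mathcomp Require Import perm.
From mathcomp Require Import all_classical all_reals all_analysis.
From mathcomp Require Import ring lra zify.

Set Implicit Arguments.
Unset Strict Implicit.
Unset Printing Implicit Defensive.

Import Order.TTheory GRing.Theory Num.Theory.
Import numFieldNormedType.Exports.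

Local Open Scope ring_scope.
Local Open Scope set_scope.

(** * Edge sets and expectations of signed weights *)

Definition pairs (n : nat) : {set {set 'I_n}} := [set e : {set 'I_n} | #|e| == 2%N].

(** The map from [(i, j)] to [[set i; j]] is a bijection from increasing pairs onto two-element
    sets. *)
Lemma prod_lt_pairs (R : realType) (n : nat) (F : {set 'I_n} -> R) :
  \prod_(i < n) \prod_(j < n | (i < j)%N) F [set i; j] =
  \prod_(e in pairs n) F e.
Proof.
rewrite pair_big_dep /=.
have -> : pairs n =
    [set [set q.1; q.2] | q in [set q : 'I_n * 'I_n | (q.1 < q.2)%N]].
  apply/setP => e; rewrite inE; apply/cards2P/imsetP => [[x [y [xy ->]]]|].
    have : (x < y)%N || (y < x)%N by rewrite -neq_ltn.
    case/orP => lt_xy; first by exists (x, y); rewrite ?inE.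
    by exists (y, x); rewrite ?inE //= finset.setUC.
  move=> [[x y]]; rewrite inE /= => lt_xy ->.
  by exists x, y; split; rewrite // neq_ltn lt_xy.
rewrite big_imset /=; first by apply: eq_bigl => q; rewrite inE.
move=> [x y] [x' y']; rewrite !inE /= => xy xy' eq_e.
have : x \in [set x'; y'] by rewrite -eq_e !inE eqxx.
have : y \in [set x'; y'] by rewrite -eq_e !inE eqxx orbT.
by case/set2P => ?; case/set2P => ?; subst => //; lia.
Qed.

(** Graphs correspond to subsets of [pairs n]. Summing over plain sets makes the distributive law
    [bigA_distr] applicable. *)
Lemma big_graph (R : realType) (n : nat) (F : {set {set 'I_n}} -> R) :
  \sum_(G : graph 'I_n) F (edges G) =
  \sum_(A : {set {set 'I_n}} | A \subset pairs n) F A.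
Proof.
rewrite (reindex_omap (val : graph 'I_n -> _)
  (fun A => insub A : option (graph 'I_n))) => [|A sA].
  apply: eq_bigl => G; apply/esym; rewrite valK eqxx andbT.
  apply/fintype.subsetP => e eG.
  by rewrite inE; have /forall_inP/(_ _ eG) := edges_card2 G.
rewrite insubT //; apply/forall_inP => e /(fintype.subsetP sA); by rewrite inE.
Qed.

(** The sum over edge sets factors over pairs. A pair outside [E] contributes [V e + (1 - V e) = 1],
    a pair in [E] contributes [V e - (1 - V e)]. *)
Lemma expectation_signed_weight (R : realType) (n : nat) (V : {set 'I_n} -> R)
    (W : 'I_n -> 'I_n -> R) (E : {set {set 'I_n}}) :
  (forall i j : 'I_n, (i < j)%N -> W i j = V [set i; j]) ->
  E \subset pairs n ->
  Defs.expectation (independent_edges W) (signed_weight R E) =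
  \prod_(e in E) (2 * V e - 1).
Proof.
move=> WV sE; rewrite /Defs.expectation /independent_edges.
pose F (A : {set {set 'I_n}}) : R :=
  (\prod_(e in pairs n) if e \in A then V e else 1 - V e) *
  \prod_(e in E) (2 * (e \in A)%:R - 1).
transitivity (\sum_(G : graph 'I_n) F (edges G)).
  apply: eq_bigr => G _; rewrite /F -prod_lt_pairs; congr (_ * _).
  by apply: eq_bigr => i _; apply: eq_bigr => j /WV ->.
(* [a] and [b] are the contributions of [e] being present and absent. The values 0 and 1 off
   [pairs n] kill every edge set that is not a graph. *)
pose a e : R := if e \in pairs n then V e else 0.
pose b e : R := if e \in pairs n then (1 - V e) * (-1) ^+ (e \in E) else 1.
rewrite big_graph; transitivity (\prod_e (a e + b e)).
  rewrite bigA_distr big_mkcond /=; apply: eq_bigr => A _.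
  case: ifPn => [sA|/subsetPn[e eA eP]]; last first.
    by rewrite (bigD1 e) //= eA /a (negPf eP) mul0r.
  rewrite /F [X in X * _]big_mkcond [X in _ * X]big_mkcond -big_split /=.
  apply: eq_bigr => e _; rewrite /a /b.
  have /implyP := fintype.subsetP sA e; have /implyP := fintype.subsetP sE e.
  case: (e \in E); case: (e \in A); case: (e \in pairs n) => //= _ _; ring.
rewrite [RHS]big_mkcond; apply: eq_bigr => e _; rewrite /a /b.
have /implyP := fintype.subsetP sE e.
case: (e \in E); case: (e \in pairs n) => //= _; ring.
Qed.

(** Each factor is 1 or -1, so factors common to [E] and [F] square to 1 and only the symmetric
    difference survives. *)
Lemma signed_weightM (R : realType) (T : finType) (E F : {set {set T}}) (G : graph T) :
  signed_weight R E G * signed_weight R F G =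
  signed_weight R ((E :\: F) :|: (F :\: E)) G.
Proof.
rewrite /signed_weight [X in X * _]big_mkcond [X in _ * X]big_mkcond -big_split /=.
rewrite [RHS]big_mkcond; apply: eq_bigr => e _; rewrite !inE.
by case: (e \in E); case: (e \in F); case: (e \in edges G) => /=; ring.
Qed.

Lemma signed_weight_le1 (R : realType) (T : finType) (E : {set {set T}}) (G : graph T) :
  signed_weight R E G <= 1.
Proof.
apply: le_trans (ler_norm _) _; rewrite normr_prod big1 // => e _.
by case: (e \in _); rewrite /= ?mulr1 ?mulr0 ?sub0r ?normrN ?normr1 //
  (_ : 2 - 1 = 1) ?normr1; lra.
Qed.

Lemma expectation_erdos_renyi (R : realType) (n : nat) (E : {set {set 'I_n}}) :
  E \subset pairs n ->
  Defs.expectation (@erdos_renyi R (1 / 2) n) (signed_weight R E) =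
  (E == finset.set0)%:R.
Proof.
move=> sE; rewrite (expectation_signed_weight (V := fun=> 1 / 2)) //.
case: (set_0Vmem E) => [->|[e eE]]; first by rewrite big_set0 eqxx.
rewrite (bigD1 e) //= (_ : 2 * (1 / 2) - 1 = 0 :> R) ?mul0r; last by field.
by case: eqP eE => // ->; rewrite inE.
Qed.

Lemma image_edges_pairs (T : finType) (H : graph T) (n : nat) (f : T -> 'I_n) :
  injective f -> image_edges f H \subset pairs n.
Proof.
move=> injf; apply/fintype.subsetP => _ /imsetP[e eH ->]; rewrite inE card_imset //.
by have /forall_inP/(_ _ eH) := edges_card2 H.
Qed.

Lemma expectation_sum (R : realType) (T : finType) (mu : graph T -> R) (I : finType)
    (A : {pred I}) (F : I -> graph T -> R) :
  Defs.expectation mu (fun G => \sum_(i in A) F i G) =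
  \sum_(i in A) Defs.expectation mu (F i).
Proof.
rewrite /Defs.expectation exchange_big; apply: eq_bigr => G _.
by rewrite big_distrr.
Qed.

(** * Copies of a graph without isolated vertices *)

Section Copies.
Variables (T : finType) (H : graph T).
Hypothesis noiso : forall v, degree H v != 0%N.

Lemma copiesP (n : nat) c :
  reflect (exists2 f : {ffun T -> 'I_n}, injective f &
           c = ([set f v | v : T], image_edges f H)) (c \in copies H n).
Proof.
by apply: (iffP imsetP) => -[f /injectiveP injf ->]; exists f.
Qed.

Lemma cover_copies (n : nat) c : c \in copies H n -> c.1 = finset.cover c.2.
Proof.
case/copiesP => f _ -> /=; apply/setP => i; apply/imsetP/bigcupP.
  move=> [v _ ->]; have := noiso v; rewrite -lt0n => /card_gt0P[e].
  rewrite inE => /andP[eH ve]; exists [set f v | v in e]; first exact: imset_f.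
  exact: imset_f.
by move=> [_ /imsetP[e eH ->] /imsetP[v ve ->]]; exists v.
Qed.

(** Without isolated vertices the vertex set is the union of the edges. Hence distinct copies have
    distinct edge sets, which orthogonality requires. *)
Lemma copies_inj (n : nat) : {in copies H n &, injective snd}.
Proof.
move=> [A E] [B F] /cover_copies /= -> /cover_copies /= ->; by move=> ->.
Qed.

Lemma copies_pairs (n : nat) c : c \in copies H n -> c.2 \subset pairs n.
Proof. by case/copiesP => f injf ->; apply: image_edges_pairs. Qed.

Lemma copies_neq0 (n : nat) c :
  (exists e, e \in edges H) -> c \in copies H n -> c.2 != finset.set0.
Proof.
move=> [e eH] /copiesP[f _ -> /=]; apply/set0Pn.
by exists [set f v | v in e]; apply: imset_f.
Qed.

Lemma leq_card_copies (n : nat) :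
  (0 < #|T| <= n)%N -> (n <= #|copies H n| * #|T|)%N.
Proof.
case/andP=> T_gt0 Tn.
pose g (v : T) : 'I_n := widen_ord Tn (enum_rank v).
have injg : injective g by move=> u v /(congr1 val) /= /val_inj /enum_rank_inj.
have [v0 _] := card_gt0P T_gt0.
have sub : [set: 'I_n] \subset \bigcup_(c in copies H n) c.1.
  apply/fintype.subsetP => i _; apply/bigcupP.
  (* Following the fixed embedding [g] by the transposition of [g v0] and [i] gives an embedding
     through [i]. *)
  pose f := [ffun v => tperm (g v0) i (g v)].
  have injf : injective f by move=> u v; rewrite !ffunE => /perm_inj /injg.
  exists ([set f v | v : T], image_edges f H); first by apply/copiesP; exists f.
  by apply/imsetP; exists v0; rewrite // ffunE tpermL.
have := subset_leq_card sub; rewrite cardsT card_ord => /leq_trans; apply.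
apply: leq_trans (_ : (\sum_(c in copies H n) #|c.1| <= _)%N).
  elim/big_rec2: _ => [|c m A _ mA]; first by rewrite cards0.
  by rewrite (leq_trans (leq_card_setU _ _)) // leq_add2l.
rewrite -sum_nat_const; apply: leq_sum => c /copiesP[f _ -> /=].
exact: leq_imset_card.
Qed.

End Copies.

Lemma expectation_signed_count (R : realType) (T : finType) (H : graph T) (n : nat)
    (mu : graph 'I_n -> R) :
  Defs.expectation mu (signed_count R H (n := n)) =
  \sum_(c in copies H n) Defs.expectation mu (signed_weight R c.2).
Proof. exact: expectation_sum. Qed.

(** * Mean and variance of the signed count under both laws *)

Section Moments.
Variables (R : realType) (T : finType) (H : graph T).
Hypothesis noiso : forall v, degree H v != 0%N.
Hypothesis edge : exists e, e \in edges H.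

Lemma erdos_renyi_mean n :
  Defs.expectation (@erdos_renyi R (1 / 2) n) (signed_count R H (n := n)) = 0.
Proof.
rewrite expectation_signed_count big1 // => c cH.
by rewrite expectation_erdos_renyi ?(copies_pairs cH) // (negPf (copies_neq0 edge cH)).
Qed.

Lemma erdos_renyi_variance n :
  Defs.variance (@erdos_renyi R (1 / 2) n) (signed_count R H (n := n)) =
  #|copies H n|%:R.
Proof.
rewrite /Defs.variance erdos_renyi_mean.
transitivity (\sum_(c in copies H n) \sum_(d in copies H n)
    Defs.expectation (@erdos_renyi R (1 / 2) n)
      (signed_weight R ((c.2 :\: d.2) :|: (d.2 :\: c.2)))).
  under eq_bigr do rewrite -expectation_sum.
  rewrite -expectation_sum; apply: eq_bigr => G _; congr (_ * _).
  rewrite subr0 expr2 /signed_count mulr_suml; apply: eq_bigr => c _.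
  by rewrite mulr_sumr; apply: eq_bigr => d _; rewrite signed_weightM.
rewrite -sum1_card natr_sum; apply: eq_bigr => c cH.
have sc := copies_pairs cH.
rewrite (bigD1 c) //= big1 => [|d /andP[dH dc]].
  by rewrite addr0 finset.setDv finset.setU0 expectation_erdos_renyi
    ?finset.sub0set ?eqxx.
rewrite expectation_erdos_renyi; last first.
  rewrite finset.subUset; apply/andP; split;
    apply: fintype.subset_trans (finset.subsetDl _ _) _ => //.
  exact: copies_pairs dH.
(* An empty symmetric difference forces equal edge sets, hence [c = d]. So the off-diagonal terms
   vanish. *)
case: eqP => // /eqP; rewrite finset.setU_eq0 !finset.setD_eq0 => E.
case/negP: dc; apply/eqP/(copies_inj noiso dH cH)/eqP.
by rewrite finset.eqEsubset andbC.
Qed.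

Variable mu : forall n, graph 'I_n -> R.
Hypothesis mu_ge0 : forall n (G : graph 'I_n), 0 <= mu G.
Hypothesis mu_sum1 : forall n, \sum_(G : graph 'I_n) mu G = 1.
Hypothesis mu_weight : forall n (f : T -> 'I_n), injective f ->
  Defs.expectation (@mu n) (signed_weight R (image_edges f H)) = 1.

(** This encodes that the weight is almost surely 1: the terms [mu G - mu G * w G] are nonnegative
    and sum to [1 - 1 = 0], so each is 0. *)
Lemma mul_signed_weight_as1 n (f : T -> 'I_n) (G : graph 'I_n) : injective f ->
  mu G * signed_weight R (image_edges f H) G = mu G.
Proof.
move=> injf; set w := signed_weight R _.
apply/eqP; rewrite eq_sym -subr_eq0; apply/eqP.
pose F G := mu G - mu G * w G.
apply: (psumr_eq0P (P := predT) (F := F)) => // [K _|].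
  by rewrite /F -[X in X - _]mulr1 -mulrBr mulr_ge0 // subr_ge0 signed_weight_le1.
by rewrite sumrB mu_sum1 -[X in _ - X]/(Defs.expectation _ _) mu_weight // subrr.
Qed.

Lemma mul_signed_count_as n (G : graph 'I_n) :
  mu G * signed_count R H G = mu G * #|copies H n|%:R.
Proof.
rewrite mulr_sumr -sum1_card natr_sum mulr_sumr; apply: eq_bigr => c.
by case/copiesP => f injf -> /=; rewrite mul_signed_weight_as1 // mulr1.
Qed.

Lemma mean_signed_count_as n :
  Defs.expectation (@mu n) (signed_count R H (n := n)) = #|copies H n|%:R.
Proof.
rewrite /Defs.expectation; under eq_bigr do rewrite mul_signed_count_as.
by rewrite -mulr_suml mu_sum1 mul1r.
Qed.

Lemma variance_signed_count_as n : Defs.variance (@mu n) (signed_count R H (n := n)) = 0.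
Proof.
rewrite /Defs.variance mean_signed_count_as; apply: big1 => G _.
by rewrite expr2 mulrA [mu G * _]mulrBr mul_signed_count_as subrr mul0r.
Qed.

Lemma card_gt0_of_edge : (0 < #|T|)%N.
Proof.
case: edge => e eH; have /forall_inP/(_ _ eH)/eqP := edges_card2 H.
by move=> e2; apply: leq_trans (max_card e); rewrite e2.
Qed.

Lemma card_copies_cvg : ((fun n => #|copies H n|%:R : R) @ \oo --> +oo%R)%classic.
Proof.
apply/cvgryPge => A; near=> n.
have T0 := card_gt0_of_edge.
have nT : (#|T| <= n)%N by near: n; exact: nbhs_infty_ge.
have /leq_trans : (Num.bound `|A| * #|T| <= n)%N by near: n; exact: nbhs_infty_ge.
have nN : (n <= #|copies H n| * #|T|)%N by apply: leq_card_copies; rewrite T0.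
move=> /(_ _ nN); rewrite leq_pmul2r // -(ler_nat R); apply: le_trans.
by apply: le_trans (ler_norm A) (ltW (archi_boundP _)).
Unshelve. all: by end_near. Qed.

Lemma distinguishes_of_weight1 : distinguishes (@signed_count R T H) mu.
Proof.
have /cvgryPge Noo := card_copies_cvg.
split.
  near=> n; rewrite mean_signed_count_as erdos_renyi_mean subr0 normr_eq0 gt_eqF //.
  by apply: lt_le_trans ltr01 _; near: n; exact: Noo.
apply/cvgrPdist_lt => e e_gt0; near=> n.
rewrite mean_signed_count_as variance_signed_count_as
  erdos_renyi_mean erdos_renyi_variance subr0 sqrtr0.
(* This threshold gives both [0 < N] and [e^-1 < Num.sqrt N]. The ratio of [Num.sqrt N] to [N] is
   then the inverse of [Num.sqrt N], below [e]. *)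
have : e^-1 ^+ 2 + 1 <= #|copies H n|%:R by near: n; exact: Noo.
move: #|_|%:R => N N_gt.
have N_gt0 : 0 < N by apply: lt_le_trans N_gt; rewrite ltr_wpDl ?sqr_ge0.
have t_gt0 : 0 < Num.sqrt N by rewrite sqrtr_gt0.
rewrite (max_idPl _) ?ltW // sub0r normrN (gtr0_norm N_gt0).
rewrite -[in X in _ / X](sqr_sqrtr (ltW N_gt0)) expr2 invfM mulVKf ?gt_eqF //.
rewrite gtr0_norm ?invr_gt0 // invf_plt ?posrE //.
rewrite -(ltr_pXn2r (n := 2)) ?nnegrE ?invr_ge0 ?ltW // sqr_sqrtr ?ltW //.
by apply: lt_le_trans N_gt; rewrite ltrDl.
Unshelve. all: by end_near. Qed.

End Moments.

(** * Block models with a rank-one matrix *)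

Section RankOne.
Variables (R : realType) (k : nat) (p : 'rV[R]_k) (s : 'I_k -> R) (Q : 'M[R]_k).
Hypothesis QE : forall a b, Q a b = s a * s b.

(** Given the labels [x], each edge contributes the product of [s (x i)] over its endpoints.
    Regrouping by vertices yields powers with the degrees as exponents, and independence of the
    labels turns the sum over [x] into a product. *)
Lemma expectation_sbm n (E : {set {set 'I_n}}) : E \subset pairs n ->
  Defs.expectation (sbm p Q (n := n)) (signed_weight R E) =
  \prod_(i < n) \sum_(a < k) p 0 a * s a ^+ #|[set e in E | i \in e]|.
Proof.
move=> sE; rewrite bigA_distr_bigA /=.
transitivity (\sum_(x : {ffun 'I_n -> 'I_k}) (\prod_(i < n) p 0 (x i)) *
    Defs.expectation (independent_edges (fun i j => (1 + Q (x i) (x j)) / 2))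
      (signed_weight R E)).
  rewrite /Defs.expectation /sbm; under eq_bigr do rewrite mulr_suml.
  rewrite exchange_big; apply: eq_bigr => x _; rewrite mulr_sumr.
  by apply: eq_bigr => G _; rewrite mulrA.
apply: eq_bigr => x _; rewrite big_split /=; congr (_ * _).
(* The rank-one form lets the edge probability be written as a function of the unordered pair. *)
rewrite (expectation_signed_weight (V := fun e => (1 + \prod_(i in e) s (x i)) / 2)) //.
  transitivity (\prod_(e in E) \prod_(i in e) s (x i)).
    by apply: eq_bigr => e _; field.
  rewrite (exchange_big_dep predT) //=; apply: eq_bigr => i _.
  by rewrite -prodr_const; apply: eq_bigl => e; rewrite inE.
move=> i j ij; rewrite QE big_setU1 ?big_set1 //= inE neq_ltn ij //.
Qed.

(** This is the case of the empty edge set: the weight is constantly 1 and every degree is 0. *)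
Lemma sbm_sum1 n : \sum_a p 0 a = 1 -> \sum_(G : graph 'I_n) sbm p Q G = 1.
Proof.
move=> p1; have := @expectation_sbm n finset.set0 (finset.sub0set _).
rewrite (eq_bigr (fun=> 1)) ?big1_eq => [<-|i _].
  by apply: eq_bigr => G _; rewrite /signed_weight big_set0 mulr1.
rewrite -[RHS]p1; apply: eq_bigr => a _.
rewrite (_ : [set _ in _ | _] = finset.set0) ?cards0 ?mulr1 //.
by apply/setP => e; rewrite !inE.
Qed.

End RankOne.

Lemma sbm_ge0 (R : realType) (k : nat) (p : 'rV[R]_k) (Q : 'M[R]_k) n (G : graph 'I_n) :
  sbm_parameters p Q -> 0 <= sbm p Q G.
Proof.
case=> p0 _ _ Q1; apply: sumr_ge0 => x _; apply: mulr_ge0.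
  by apply: prodr_ge0 => i _; case/andP: (p0 (x i)) => /ltW.
apply: prodr_ge0 => i _; apply: prodr_ge0 => j _.
by have /andP[] := Q1 (x i) (x j); case: ifP => _ *; lra.
Qed.

Lemma degree_image (T U : finType) (H : graph T) (f : T -> U) v : injective f ->
  #|[set e in image_edges f H | f v \in e]| = degree H v.
Proof.
move=> injf; rewrite /degree -(card_imset _ (imset_inj injf)).
apply: eq_card => e; rewrite inE; apply/andP/imsetP.
  move=> [/imsetP[d dH ->]]; rewrite mem_imset // => vd.
  by exists d; rewrite // inE dH.
by move=> [d]; rewrite inE => /andP[dH vd] ->; split;
  [apply: imset_f | rewrite mem_imset].
Qed.

Lemma degree_image0 (T U : finType) (H : graph T) (f : T -> U) i :
  (forall v, i != f v) -> #|[set e in image_edges f H | i \in e]| = 0%N.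
Proof.
move=> fi; apply: eq_card0 => e; rewrite inE; apply/negP => /andP[/imsetP[d _ ->]].
by case/imsetP => v _ /eqP; rewrite (negPf (fi v)).
Qed.

(** Every vertex factor reduces to the sum of [p]: on the image of [f] by the hypothesis on [s],
    elsewhere because the degree is 0. *)
Lemma Phi_rank_one_eq1 (R : realType) (k : nat) (p : 'rV[R]_k) (s : 'I_k -> R)
    (Q : 'M[R]_k) (T : finType) (H : graph T) n (f : T -> 'I_n) :
  (forall a b, Q a b = s a * s b) -> \sum_a p 0 a = 1 ->
  (forall a v, s a ^+ degree H v = 1) -> injective f -> Phi p Q H f = 1.
Proof.
move=> QE p1 s1 injf; rewrite /Phi (expectation_sbm _ QE) ?image_edges_pairs //.
apply: big1 => i _; rewrite -[RHS]p1; apply: eq_bigr => a _.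
case: (pickP (fun v => i == f v)) => [v /eqP ->|fi].
  by rewrite degree_image // s1 mulr1.
by rewrite degree_image0 ?mulr1 // => v; rewrite fi.
Qed.

(** * The four-cycle and the two-community model *)

Lemma cycle4_degree v : degree cycle4 v = 2%N.
Proof.
have e01 : edges cycle4 = [set [set i; ordS i] | i : 'I_4] by [].
rewrite /degree e01.
have -> : [set e in [set [set i; ordS i] | i : 'I_4] | v \in e] =
    [set [set v; ordS v]; [set ord_pred v; v]].
  apply/setP => e; rewrite !inE; apply/andP/orP.
    case=> /imsetP[i _ ->] /set2P[->|->]; first by left.
    by right; rewrite ordSK.
  case=> /eqP ->; rewrite !inE eqxx ?orbT; split=> //; first exact: imset_f.
  by rewrite -{2}(ord_predK v); apply: imset_f.
(* The two edges at [v] differ, since the successor of [v] modulo 4 is neither [v] nor its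
   predecessor. *)
rewrite cards2; case: eqP => // /setP/(_ (ordS v)); rewrite !inE eqxx orbT.
by case: v => -[|[|[|[|]]]].
Qed.

Theorem theoremA2 (R : realType) :
  let p : 'rV[R]_2 := const_mx (1 / 2) in
  exists Q : 'M[R]_2,
    [/\ sbm_parameters p Q,
        (forall (T : finType) (H : graph T) (n : nat) (f : T -> 'I_n),
           injective f -> (exists v, odd (degree H v)) -> Phi p Q H f = 0),
        (forall (T : finType) (H : graph T) (n : nat) (f : T -> 'I_n),
           injective f -> (forall v, ~~ odd (degree H v)) -> Phi p Q H f = 1),
        distinguishes (@signed_count R _ cycle4) (@sbm R 2 p Q)
      & forall (T : finType) (H : graph T),
          (forall v, degree H v != 0%N) ->
          (exists e, e \in edges H) ->
          distinguishes (@signed_count R T H) (@sbm R 2 p (map_mx Num.norm Q))].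
Proof.
move=> p; pose s (a : 'I_2) : R := (-1) ^+ a.
pose Q : 'M[R]_2 := \matrix_(a, b) (s a * s b); exists Q.
have QE a b : Q a b = s a * s b by rewrite mxE.
have normQ a b : `|Q a b| = 1 by rewrite QE normrM !normrX normrN normr1 !expr1n mulr1.
have absQE a b : map_mx Num.norm Q a b = 1 * 1 by rewrite mxE normQ mulr1.
have p1 : \sum_a p 0 a = 1 by rewrite !big_ord_recl big_ord0 !mxE; field.
have p01 a : 0 < p 0 a <= 1 by rewrite mxE; lra.
have paramQ : sbm_parameters p Q.
  by split=> // a b; [rewrite !QE mulrC | rewrite -ler_norml normQ].
have paramA : sbm_parameters p (map_mx Num.norm Q).
  by split=> // a b; rewrite !absQE //; lra.
have even1 (T : finType) (H : graph T) (n : nat) (f : T -> 'I_n) :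
    injective f -> (forall v, ~~ odd (degree H v)) -> Phi p Q H f = 1.
  move=> injf even; apply: (Phi_rank_one_eq1 QE) => // a v.
  (* Swapping the exponents [a] and [degree H v] leaves a power of [(-1) ^+ degree H v], which is 1
     by parity. *)
  by rewrite /s exprAC -signr_odd (negPf (even v)) expr1n.
split=> //.
- move=> T H n f injf [v oddv].
  (* The factor at the odd vertex is [1 / 2 - 1 / 2 = 0]. *)
  rewrite /Phi (expectation_sbm _ QE) ?image_edges_pairs // (bigD1 (f v)) //=.
  rewrite degree_image // !big_ord_recl big_ord0 !mxE /s /= expr0 expr1 expr1n.
  by rewrite -signr_odd oddv expr1; ring.
- apply: distinguishes_of_weight1 => [v||n G|n|n f injf].
  + by rewrite cycle4_degree.
  + by exists [set ord0; ordS ord0]; apply: imset_f.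
  + exact: sbm_ge0.
  + exact: sbm_sum1 QE _ p1.
  (* All degrees of the four-cycle equal 2, so [Phi] is already 1 for the signed matrix [Q]. *)
  + by apply: even1 => // v; rewrite cycle4_degree.
- move=> T H noiso edge.
  apply: distinguishes_of_weight1 => // [n G|n|n f injf].
  + exact: sbm_ge0.
  (* The all-ones matrix [|Q|] is rank one with constant [s = 1], whose powers are 1 whatever the
     degrees. *)
  + exact: (sbm_sum1 (s := fun=> 1)).
  + by apply: (Phi_rank_one_eq1 (s := fun=> 1)) => // a v; rewrite expr1n.
Qed.
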